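(* Let $A\in\mathbb{R}^{n\times d}$, let $k\ge1$ satisfy $k\le\mathrm{rank}(A)$ and $\sigma_k(A)>\sigma_{k+1}(A)$, and let $b=f+\xi$ be as in the fixed design model. Suppose that $R\in\mathbb{R}^{d\times s}$ where $s\ge k$, and that $\mathrm{rank}(AR)\ge k$. If $d_2(U_{AR,k},U_{A,k})\le\nu<1$, then $$\mathcal{E}(x_{R,k})\le\mathcal{E}(x_k)+\frac{(2\nu+\nu^2)\|f\|_2^2}{n}.$$
   Context: $\|\cdot\|_2$ is the Euclidean/spectral norm. $\sigma_1(A)\ge\sigma_2(A)\ge\cdots$ are the singular values of $A$ . For a matrix $X$ with thin SVD $X=U_X\Sigma_XV_X^{T}$, $U_{X,k}$ and $V_{X,k}$ are the first $k$ columns of $U_X$ and $V_X$; statements are meant for any such decomposition. $d_2(U,W)=\|P_U-P_W\|_2$, with $P_X$ the orthogonal projection onto the column space of $X$. $X^{+}$ is the Moore–Penrose pseudo-inverse. $x_k=V_{A,k}(AV_{A,k})^{+}b$ is the rank-$k$ principal component regression solution $\arg\min_{x\in\mathrm{range}(V_{A,k})}\|Ax-b\|_2$, and $x_{R,k}=RV_{AR,k}(ARV_{AR,k})^{+}b$. Fixed design model: $A$ and $f\in\mathbb{R}^n$ are fixed, and $b=f+\xi$ where the entries of $\xi$ are independent with mean $0$ and variance $\sigma^2$. $x^\star$ is the minimum-norm minimizer of $\mathbb{E}[\|Ax-b\|_2^2/n]$ over $x\in\mathbb{R}^d$ (so $Ax^\star=P_Af$). The excess risk of an estimator $\theta=\theta(A,b)$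 is $\mathcal{E}(\theta)=\mathbb{E}[\|A\theta-Ax^\star\|_2^2/n]$, expectation over $\xi$. *)

(* Defs.v *)
From HB Require Import structures.
From mathcomp Require Import all_boot all_order all_algebra.
From mathcomp Require Import all_classical all_reals all_analysis.

Set Implicit Arguments.
Unset Strict Implicit.
Unset Printing Implicit Defensive.

Import Order.TTheory GRing.Theory Num.Theory.

Local Open Scope ring_scope.
Local Open Scope classical_set_scope.

(* The library norm on matrices is the sup norm, hence the definition below. *)
Definition l2norm (R : realType) (n : nat) (x : 'cV[R]_n) : R :=
  Num.sqrt (\sum_(i < n) x i ord0 ^+ 2).

Definition spectral_norm (R : realType) (m n : nat) (M : 'M[R]_(m, n)) : R :=
  sup [set l2norm (M *m x) | x in [set x : 'cV[R]_n | l2norm x <= 1]].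

Record thin_svd (R : realType) (n d : nat) (X : 'M[R]_(n, d)) := ThinSVD {
  svdU : 'M[R]_(n, minn n d);
  svdS : 'rV[R]_(minn n d);
  svdV : 'M[R]_(d, minn n d);
  svd_eq : X = svdU *m diag_mx svdS *m svdV^T;
  svdU_orthonormal : svdU^T *m svdU = 1%:M;
  svdV_orthonormal : svdV^T *m svdV = 1%:M;
  svdS_ge0 : forall i, 0 <= svdS ord0 i;
  svdS_noninc : forall i j : 'I_(minn n d), (i <= j)%N ->
    svdS ord0 j <= svdS ord0 i }.

(* The i-th singular value, with i counted from 1; it is 0 for i > minn n d. *)
Definition singular_value (R : realType) (n d : nat) (X : 'M[R]_(n, d))
    (D : thin_svd X) (i : nat) : R :=
  nth 0 [seq svdS D ord0 j | j <- enum 'I_(minn n d)] i.-1.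

(* For k <= m these are the first k columns of U (see firstcolsE); columns past
   the m-th, if any, are 0. *)
Definition firstcols (R : realType) (n m k : nat) (U : 'M[R]_(n, m)) :
    'M[R]_(n, k) :=
  U *m pid_mx k.

Lemma firstcolsE (R : realType) (n m k : nat) (U : 'M[R]_(n, m))
    (le_km : (k <= m)%N) :
  firstcols k U = colsub (widen_ord le_km) U.
Proof.
apply/matrixP => i j; rewrite !mxE (bigD1 (widen_ord le_km j)) //= !mxE /=.
rewrite eqxx ltn_ord mulr1 big1 ?addr0// => l lj; rewrite !mxE.
by case: eqP => [e|_]; [rewrite -val_eqE /= e eqxx in lj|rewrite mulr0].
Qed.

Definition is_pinv (R : realType) (m n : nat) (X : 'M[R]_(m, n))
    (Y : 'M[R]_(n, m)) : Prop :=
  [/\ X *m Y *m X = X, Y *m X *m Y = Y,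
      (X *m Y)^T = X *m Y & (Y *m X)^T = Y *m X].

(* mathcomp's pinvmx is only a partial inverse, not the Moore-Penrose one. *)
Definition pinv (R : realType) (m n : nat) (X : 'M[R]_(m, n)) : 'M[R]_(n, m) :=
  xget 0 [set Y | is_pinv X Y].

Definition is_orthproj (R : realType) (m n : nat) (X : 'M[R]_(m, n))
    (P : 'M[R]_m) : Prop :=
  forall y : 'cV[R]_m,
    (exists z : 'cV[R]_n, P *m y = X *m z) /\ X^T *m (y - P *m y) = 0.

Definition orthproj (R : realType) (m n : nat) (X : 'M[R]_(m, n)) : 'M[R]_m :=
  xget 0 [set P | is_orthproj X P].

Lemma gram_unit (R : realType) (m r : nat) (C : 'M[R]_(m, r)) :
  row_free C^T -> C^T *m C \in unitmx.
Proof.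
move=> fC; rewrite -row_free_unit -kermx_eq0; apply/eqP/row_matrixP => i.
set u := row i _; have u0 : u *m (C^T *m C) = 0.
  by apply/sub_kermxP; exact: row_sub.
have v0 : u *m C^T *m (u *m C^T)^T = 0.
  by rewrite trmx_mul trmxK -mulmxA (mulmxA C^T) mulmxA u0 mul0mx.
suff: u *m C^T = 0 by move/eqP; rewrite mulmx_free_eq0// => /eqP ->; rewrite row0.
move: v0; set w := u *m C^T => /matrixP /(_ ord0 ord0); rewrite !mxE => w2.
have w2_ge0 (j : 'I_m) : true -> 0 <= w ord0 j * w^T j ord0.
  by rewrite [w^T _ _]mxE -expr2 sqr_ge0.
apply/rowP => j; rewrite [RHS]mxE; have /= := psumr_eq0P w2_ge0 w2 (i:=j) isT.
by rewrite [w^T _ _]mxE => /eqP; rewrite mulf_eq0 orbb => /eqP.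
Qed.

Lemma pinvP (R : realType) (m n : nat) (X : 'M[R]_(m, n)) : is_pinv X (pinv X).
Proof.
rewrite /pinv; apply: (@xgetPex _ 0 [set Y | is_pinv X Y]).
have [r [C [F [XE fC fF]]]] : exists r (C : 'M[R]_(m, r)) (F : 'M[R]_(r, n)),
    [/\ X = C *m F, row_full C & row_free F].
  exists (\rank X), (col_base X), (row_base X).
  by split; [rewrite mulmx_base | exact: col_base_full | exact: row_base_free].
have uC : C^T *m C \in unitmx by apply: gram_unit; rewrite /row_free mxrank_tr.
have uF : F *m F^T \in unitmx.
  by rewrite -{1}[F]trmxK; apply: gram_unit; rewrite trmxK.
pose G := invmx (C^T *m C); pose H := invmx (F *m F^T).
have GT : G^T = G by rewrite trmx_inv trmx_mul trmxK.
have HT : H^T = H by rewrite trmx_inv trmx_mul trmxK.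
pose Y := F^T *m H *m G *m C^T.
have XY : X *m Y = C *m G *m C^T.
  by rewrite XE /Y !mulmxA -(mulmxA C F) -(mulmxA C _ H) mulmxV ?mulmx1.
have YX : Y *m X = F^T *m H *m F.
  rewrite XE /Y !mulmxA -(mulmxA _ C^T C) -(mulmxA _ G (C^T *m C)).
  by rewrite mulVmx ?mulmx1.
exists Y; split.
- rewrite XY XE !mulmxA -(mulmxA _ C^T C) -(mulmxA _ G (C^T *m C)).
  by rewrite mulVmx ?mulmx1.
- rewrite YX /Y !mulmxA -(mulmxA _ F F^T) -(mulmxA _ H (F *m F^T)).
  by rewrite mulVmx ?mulmx1.
- by rewrite XY !trmx_mul GT trmxK mulmxA.
- by rewrite YX !trmx_mul HT trmxK mulmxA.
Qed.

Lemma orthprojP (R : realType) (m n : nat) (X : 'M[R]_(m, n)) :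
  is_orthproj X (orthproj X).
Proof.
rewrite /orthproj; apply: (@xgetPex _ 0 [set P | is_orthproj X P]).
have [XYX _ XYT _] := pinvP X.
exists (X *m pinv X) => y; split; first by exists (pinv X *m y); rewrite mulmxA.
apply/eqP; rewrite mulmxBr subr_eq0 mulmxA; apply/eqP.
by congr (_ *m y); rewrite -{1}XYX trmx_mul XYT.
Qed.

(* The distance between the column spaces of U and W. *)
Definition d2 (R : realType) (n p q : nat) (U : 'M[R]_(n, p))
    (W : 'M[R]_(n, q)) : R :=
  spectral_norm (orthproj U - orthproj W).

(* x_k = V_k (A V_k)^+ b and x_{S,k} = S V_{AS,k} (A S V_{AS,k})^+ b. *)
Definition pcr (R : realType) (n d k : nat) (A : 'M[R]_(n, d))
    (D : thin_svd A) (b : 'cV[R]_n) : 'cV[R]_d :=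
  let Vk := firstcols k (svdV D) in Vk *m pinv (A *m Vk) *m b.

Definition sketched_pcr (R : realType) (n d s k : nat) (A : 'M[R]_(n, d))
    (S : 'M[R]_(d, s)) (D : thin_svd (A *m S)) (b : 'cV[R]_n) : 'cV[R]_d :=
  let Vk := firstcols k (svdV D) in S *m Vk *m pinv (A *m S *m Vk) *m b.

Definition mutually_independent (disp : measure_display)
    (T : measurableType disp) (R : realType) (P : probability T R) (n : nat)
    (X : 'I_n -> {RV P >-> R}) : Prop :=
  forall (J : {set 'I_n}) (B : 'I_n -> set R),
    (forall i, i \in J -> measurable (B i)) ->
    P [set w | forall i, i \in J -> B i (X i w)] =
    (\prod_(i in J) P (X i @^-1` B i))%E.

Definition response (disp : measure_display) (T : measurableType disp)
    (R : realType) (P : probability T R) (n : nat) (f : 'cV[R]_n)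
    (xi : 'I_n -> {RV P >-> R}) (w : T) : 'cV[R]_n :=
  f + \col_i xi i w.

Definition risk (disp : measure_display) (T : measurableType disp)
    (R : realType) (P : probability T R) (n d : nat) (A : 'M[R]_(n, d))
    (b : T -> 'cV[R]_n) (x : 'cV[R]_d) : \bar R :=
  'E_P[fun w => (l2norm (A *m x - b w) ^+ 2 / n%:R)%R]%E.

Definition min_norm_minimizer (R : realType) (d : nat)
    (F : 'cV[R]_d -> \bar R) (x : 'cV[R]_d) : Prop :=
  (forall y, (F x <= F y)%E) /\
  (forall y, (forall z, (F y <= F z)%E) -> l2norm x <= l2norm y).

(* An estimator is a function theta of the observed response; A is fixed. *)
Definition excess_risk (disp : measure_display) (T : measurableType disp)
    (R : realType) (P : probability T R) (n d : nat) (A : 'M[R]_(n, d))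
    (b : T -> 'cV[R]_n) (xstar : 'cV[R]_d) (theta : 'cV[R]_n -> 'cV[R]_d) :
    \bar R :=
  'E_P[fun w => (l2norm (A *m theta (b w) - A *m xstar) ^+ 2 / n%:R)%R]%E.

(* Main.v *)
Require Import Defs.
From mathcomp Require Import all_boot all_order all_algebra.
From mathcomp Require Import all_classical all_reals all_analysis.
From mathcomp Require Import measurable_realfun ring lra.

(** Applying either estimator and then [A] is an orthogonal projection of the
    data. Write [Q1] and [Q0] for the orthogonal projections onto the spans of
    the first [k] left singular vectors of [A *m S] and of [A]. Since both
    matrices have rank at least [k], their [k] largest singular values are
    nonzero, so [X *m V_k *m (X *m V_k)^+ = U_k *m U_k^T] for [X := A *m S] and
    for [X := A] ([fitted_firstcols]); hence the two fitted vectors are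
    [Q1 *m b] and [Q0 *m b].

    The target [A *m xstar] is [g := A *m A^+ *m f], by Pythagoras
    ([min_norm_minimizer_fitted]). As [b = f + xi] with [xi] centred,
    uncorrelated and of variance [sigma^2], the excess risk of a projection [Q]
    is a bias plus a variance, [(l2norm (Q f - g)^2 + sigma^2 tr Q) / n]. The
    variance terms agree, because [Q1] and [Q0] both have trace [k]. Both ranges
    lie in the range of [A], so [Q g = Q f] and the bias is
    [l2norm g ^ 2 - f^T Q f] ([excess_riskE]). What remains of the difference of
    the excess risks is [f^T (Q0 - Q1) f / n], which Cauchy-Schwarz bounds by
    [d2 * l2norm f ^ 2 / n], hence by [nu * l2norm f ^ 2 / n]. This is at most
    the claimed [(2 nu + nu^2) l2norm f ^ 2 / n], as [nu >= d2 >= 0].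

    The probabilistic input is that [E (xi_i xi_j) = 0] for [i <> j]
    ([has_mean_indepM]). Independence is a product rule for events, so it says
    that the joint law of [(xi_i, xi_j)] is a product measure, and Fubini's
    theorem applies ([integral_indep]). *)

Set Implicit Arguments.
Unset Strict Implicit.
Unset Printing Implicit Defensive.

Import Order.TTheory GRing.Theory Num.Theory.

Local Open Scope ring_scope.

(** * The Euclidean norm and the spectral norm *)

Section euclidean.
Context (R : realType).

Lemma l2norm_ge0 (n : nat) (x : 'cV[R]_n) : 0 <= l2norm x.
Proof. exact: sqrtr_ge0. Qed.

Lemma l2norm_sqr_sum (n : nat) (x : 'cV[R]_n) :
  l2norm x ^+ 2 = \sum_i x i ord0 ^+ 2.
Proof. by rewrite sqr_sqrtr// sumr_ge0// => i _; exact: sqr_ge0. Qed.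

Lemma l2norm_sqr (n : nat) (x : 'cV[R]_n) :
  l2norm x ^+ 2 = (x^T *m x) ord0 ord0.
Proof.
by rewrite l2norm_sqr_sum mxE; apply: eq_bigr => i _; rewrite mxE expr2.
Qed.

Lemma l2norm_eq0 (n : nat) (x : 'cV[R]_n) : l2norm x = 0 -> x = 0.
Proof.
move=> x0; have := l2norm_sqr_sum x; rewrite x0 expr0n/= => /esym s0.
apply/colP => i; rewrite mxE; apply/eqP; rewrite -sqrf_eq0; apply/eqP.
by apply: (psumr_eq0P _ s0) => // j _; exact: sqr_ge0.
Qed.


Lemma l2normZ (n : nat) (a : R) (x : 'cV[R]_n) : 0 <= a ->
  l2norm (a *: x) = a * l2norm x.
Proof.
move=> a0; apply/eqP; rewrite -(eqrXn2 (n := 2)) ?mulr_ge0 ?l2norm_ge0//.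
rewrite exprMn !l2norm_sqr_sum mulr_sumr; apply/eqP/eq_bigr => i _.
by rewrite mxE exprMn.
Qed.

Lemma l2normN (n : nat) (x : 'cV[R]_n) : l2norm (- x) = l2norm x.
Proof. by rewrite /l2norm; under eq_bigr do rewrite mxE sqrrN. Qed.

Lemma l2norm_sqrD (n : nat) (x y : 'cV[R]_n) :
  l2norm (x + y) ^+ 2 =
  l2norm x ^+ 2 + l2norm y ^+ 2 + (x^T *m y) ord0 ord0 *+ 2.
Proof.
rewrite !l2norm_sqr_sum mxE -sumrMnl -!big_split/=; apply: eq_bigr => i _.
by rewrite !mxE sqrrD addrAC.
Qed.

(** With [a] and [b] the norms of [x] and [y], the square norm of
    [b *: x - a *: y] equals [2 a b (a b - x^T y)]. *)
Lemma cauchy_schwarz (n : nat) (x y : 'cV[R]_n) :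
  (x^T *m y) ord0 ord0 <= l2norm x * l2norm y.
Proof.
have [/l2norm_eq0 ->|x0] := eqVneq (l2norm x) 0.
  by rewrite trmx0 mul0mx mxE mulr_ge0 ?l2norm_ge0.
have [/l2norm_eq0 ->|y0] := eqVneq (l2norm y) 0.
  by rewrite mulmx0 mxE mulr_ge0 ?l2norm_ge0.
set a := l2norm x in x0 *; set b := l2norm y in y0 *.
have ab : 0 < a * b by rewrite mulr_gt0// lt_def ?x0 ?y0 l2norm_ge0.
have xyT : (b *: x)^T *m - (a *: y) = - ((a * b) *: (x^T *m y)).
  by rewrite mulmxN -scalemxAr [(b *: x)^T]linearZ -scalemxAl scalerA.
have := sqr_ge0 (l2norm (b *: x - a *: y)).
rewrite l2norm_sqrD xyT l2normN !l2normZ ?l2norm_ge0// -/a -/b.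
rewrite [X in X *+ 2]mxE [X in - X]mxE (mulrC b a) mulNrn -mulr2n -mulrnBl.
rewrite pmulrn_lge0// subr_ge0 expr2.
by rewrite ler_pM2l.
Qed.

(** The Frobenius bound. It shows that the set whose supremum defines the
    spectral norm is bounded. *)
Lemma l2norm_mulmx_le (m n : nat) (M : 'M[R]_(m, n)) (x : 'cV[R]_n) :
  l2norm (M *m x) <=
  Num.sqrt (\sum_i l2norm (row i M)^T ^+ 2) * l2norm x.
Proof.
have s0 : 0 <= \sum_i l2norm (row i M)^T ^+ 2.
  by apply: sumr_ge0 => i _; exact: sqr_ge0.
rewrite -(ler_pXn2r (n := 2)) ?nnegrE ?mulr_ge0 ?sqrtr_ge0 ?l2norm_ge0//.
rewrite exprMn [leLHS]l2norm_sqr_sum sqr_sqrtr// mulr_suml.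
apply: ler_sum => i _.
have e (z : 'cV[R]_n) : (M *m z) i ord0 = ((row i M)^T^T *m z) ord0 ord0.
  by rewrite trmxK -row_mul [RHS]mxE.
rewrite -exprMn -real_normK ?num_real//.
rewrite ler_pXn2r ?nnegrE ?mulr_ge0 ?l2norm_ge0//.
rewrite ler_norml e cauchy_schwarz andbT lerNl.
have := cauchy_schwarz (row i M)^T (- x); rewrite l2normN.
by rewrite mulmxN mxE.
Qed.

Lemma l2norm0 (n : nat) : l2norm (0 : 'cV[R]_n) = 0.
Proof.
by rewrite /l2norm big1 ?sqrtr0// => i _; rewrite mxE expr0n.
Qed.

Section spectral.
Context (m n : nat) (M : 'M[R]_(m, n)).

Lemma spectral_norm_ub (x : 'cV[R]_n) :
  l2norm x <= 1 -> l2norm (M *m x) <= spectral_norm M.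
Proof.
move=> x1; apply: ub_le_sup; last by exists x.
exists (Num.sqrt (\sum_i l2norm (row i M)^T ^+ 2)) => _ [y /= y1 <-].
by apply: le_trans (l2norm_mulmx_le M y) _; rewrite ler_piMr ?sqrtr_ge0.
Qed.

Lemma spectral_norm_ge0 : 0 <= spectral_norm M.
Proof.
by have := @spectral_norm_ub 0; rewrite mulmx0 !l2norm0; apply; exact: ler01.
Qed.

Lemma l2norm_mulmx_spectral (x : 'cV[R]_n) :
  l2norm (M *m x) <= spectral_norm M * l2norm x.
Proof.
have [/l2norm_eq0 ->|x0] := eqVneq (l2norm x) 0.
  by rewrite mulmx0 !l2norm0 mulr0.
have xp : 0 < l2norm x by rewrite lt_def x0 l2norm_ge0.
rewrite -ler_pdivrMr// mulrC -l2normZ ?invr_ge0 ?l2norm_ge0// scalemxAr.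
by apply: spectral_norm_ub; rewrite l2normZ ?invr_ge0 ?l2norm_ge0// mulVf.
Qed.

Lemma mulmx_spectral_le (x : 'cV[R]_n) (y : 'cV[R]_m) :
  (y^T *m M *m x) ord0 ord0 <= spectral_norm M * l2norm x * l2norm y.
Proof.
rewrite -mulmxA; apply: le_trans (cauchy_schwarz _ _) _.
by rewrite mulrC ler_wpM2r ?l2norm_ge0// l2norm_mulmx_spectral.
Qed.

End spectral.

End euclidean.

(** * Projection onto the leading left singular vectors *)

Section projections.
Context (R : realType).

(** [orthproj U *m y = U *m z] for some [z], and orthogonality of the residual
    to [U] forces [z = U^T *m y]. *)
Lemma orthproj_isometry (n k : nat) (U : 'M[R]_(n, k)) :
  U^T *m U = 1%:M -> orthproj U = U *m U^T.
Proof.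
move=> UU; have HU := orthprojP U.
suff e (y : 'cV[R]_n) : orthproj U *m y = U *m U^T *m y.
  apply/matrixP => i j; have /colP/(_ i) := e (delta_mx j ord0).
  by rewrite -!colE !mxE.
have [[z yz]] := HU y; rewrite yz mulmxBr !mulmxA UU mul1mx.
by move/eqP; rewrite subr_eq0 => /eqP <-; rewrite mulmxA.
Qed.

(** [X := U *m D] and [U] have the same column space, so the two symmetric
    idempotents [X *m X^+] and [U *m U^T] absorb each other:
    [U U^T (X X^+) = X X^+] and [X X^+ (U U^T) = U U^T]. Transposing the first
    identity gives the equality. *)
Lemma mulmx_pinv_isometry (n k : nat) (U : 'M[R]_(n, k)) (D : 'M[R]_k) :
  U^T *m U = 1%:M -> D \in unitmx ->
  U *m D *m Defs.pinv (U *m D) = U *m U^T.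
Proof.
move=> UU uD; have [XYX _ XYT _] := Defs.pinvP (U *m D).
set X := U *m D in XYX XYT *; set Y := Defs.pinv X in XYX XYT *.
have XYU : X *m Y *m U = U.
  by rewrite -[U in LHS](mulmxK uD) -/X (mulmxA _ X) XYX /X mulmxK.
have e1 : U *m U^T *m (X *m Y) = X *m Y.
  by rewrite /X !mulmxA -(mulmxA U U^T U) UU mulmx1.
have e2 : X *m Y *m (U *m U^T) = U *m U^T.
  by rewrite mulmxA XYU.
by rewrite -XYT -e1 trmx_mul XYT trmx_mul trmxK e2.
Qed.

Section svd.
Context (n d k : nat) (X : 'M[R]_(n, d)) (D : thin_svd X).
Hypothesis rank_X : (k <= \rank X)%N.

Let le_k_min : (k <= minn n d)%N.
Proof. by rewrite (leq_trans rank_X)// leq_min rank_leq_row rank_leq_col. Qed.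

Lemma firstcols_svdU_orthonormal :
  (firstcols k (svdU D))^T *m firstcols k (svdU D) = 1%:M.
Proof.
rewrite /firstcols trmx_mul !mulmxA -(mulmxA _ (svdU D)^T) svdU_orthonormal.
by rewrite mulmx1 tr_pid_mx mul_pid_mx minnn (minn_idPr le_k_min) pid_mx_1.
Qed.

(** If the [j]-th singular value vanished for some [j < k], so would all later
    ones by monotonicity, and the rank of [X] would be at most [j]. *)
Lemma svdS_neq0 (j : 'I_(minn n d)) : (j < k)%N -> svdS D ord0 j != 0.
Proof.
move=> jk; apply/eqP => Sj0; move: rank_X; apply/negP; rewrite -ltnNge.
apply: leq_ltn_trans jk; rewrite {1}(svd_eq D).
apply: (leq_trans (mxrankM_maxl _ _)); apply: (leq_trans (mxrankM_maxr _ _)).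
have -> : diag_mx (svdS D) = diag_mx (svdS D) *m pid_mx j.
  apply/matrixP => i l; rewrite mul_diag_mx !mxE.
  have [<-|il] := eqVneq i l; last first.
    by rewrite -val_eqE in il; rewrite (negbTE il) mulr0.
  rewrite eqxx/=; case: (ltnP i j) => [_|ji]; first by rewrite mulr1.
  rewrite mulr0 mulr1n; apply/eqP; rewrite eq_le svdS_ge0 andbT -Sj0.
  exact: svdS_noninc.
apply: (leq_trans (mxrankM_maxr _ _)); rewrite rank_pid_mx//; exact: ltnW.
Qed.

(** [C] is the diagonal matrix of the [k] largest singular values. *)
Lemma mulmx_firstcols_svdV : exists2 C : 'M[R]_k, C \in unitmx &
  X *m firstcols k (svdV D) = firstcols k (svdU D) *m C.
Proof.
pose C := diag_mx (\row_(j < k) svdS D ord0 (widen_ord le_k_min j)).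
exists C.
  rewrite unitmxE det_diag unitfE; apply/prodf_neq0 => j _; rewrite mxE.
  by apply: svdS_neq0; exact: (ltn_ord j).
rewrite {1}(svd_eq D) /firstcols !mulmxA -(mulmxA _ (svdV D)^T).
rewrite svdV_orthonormal mulmx1 -!mulmxA; congr (_ *m _).
apply/matrixP => i j; rewrite mul_diag_mx mul_mx_diag !mxE.
case: eqP => [ij|_]; last by rewrite mulr0 mul0r.
rewrite mulrC; congr (_ * svdS D _ _); exact/val_inj.
Qed.

Lemma fitted_firstcols (Vk := firstcols k (svdV D))
    (Uk := firstcols k (svdU D)) :
  X *m Vk *m Defs.pinv (X *m Vk) = Uk *m Uk^T.
Proof.
rewrite /Vk; have [C uC ->] := mulmx_firstcols_svdV.
exact: mulmx_pinv_isometry firstcols_svdU_orthonormal uC.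
Qed.

End svd.

End projections.

(** * Moments of independent noise *)

Section mean.
Context (disp : measure_display) (T : measurableType disp) (R : realType)
  (P : probability T R).

(** Integrability is bundled with the value of the mean: the integral alone is
    additive only on integrable functions, whereas this relation is closed
    under every linear combination. *)
Definition has_mean (X : T -> R) (m : R) : Prop :=
  P.-integrable [set: T] (EFin \o X) /\ (\int[P]_w (X w)%:E = m%:E)%E.

Lemma has_mean_expectation (X : T -> R) (m : R) :
  has_mean X m -> ('E_P[X] = m%:E)%E.
Proof. by case=> _ <-; rewrite unlock. Qed.

Lemma has_mean_cst (c : R) : has_mean (fun=> c) c.
Proof.
split; first exact: finite_measure_integrable_cst.
by rewrite integral_cst//= probability_setT mule1.
Qed.

Lemma has_meanD (X Y : T -> R) (m p : R) :
  has_mean X m -> has_mean Y p -> has_mean (fun w => X w + Y w) (m + p).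
Proof.
move=> [iX eX] [iY eY]; split; first exact: (integrableD measurableT iX iY).
by rewrite (integralD_EFin measurableT iX iY) /= eX eY.
Qed.

Lemma has_meanZ (c : R) (X : T -> R) (m : R) :
  has_mean X m -> has_mean (fun w => c * X w) (c * m).
Proof.
move=> [iX eX]; split; first exact: (integrableZl measurableT c iX).
by rewrite EFinM -eX -(integralZl measurableT iX).
Qed.

Lemma has_mean_sum (I : Type) (r : seq I) (X : I -> T -> R) (m : I -> R) :
  (forall i, has_mean (X i) (m i)) ->
  has_mean (fun w => \sum_(i <- r) X i w) (\sum_(i <- r) m i).
Proof.
move=> Xm; elim: r => [|i r IHr].
  by rewrite big_nil; under eq_fun do rewrite big_nil; exact: has_mean_cst.
by rewrite big_cons; under eq_fun do rewrite big_cons; exact: has_meanD.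
Qed.

End mean.

Section joint_law.
Context (disp : measure_display) (T : measurableType disp) (R : realType)
  (P : probability T R).
Context (d1 d2 : measure_display) (T1 : measurableType d1)
  (T2 : measurableType d2) (X : {mfun T >-> T1}) (Y : {mfun T >-> T2}).
Hypothesis indepXY : forall (B : set T1) (C : set T2),
  measurable B -> measurable C ->
  P (X @^-1` B `&` Y @^-1` C)%classic =
  (P (X @^-1` B)%classic * P (Y @^-1` C)%classic)%E.

(** By the product rule on rectangles and uniqueness of product measures, the
    joint law of [X] and [Y] is the product of their laws. *)
Lemma integral_indep (h : T1 * T2 -> \bar R) :
  measurable_fun [set: T1 * T2] h ->
  P.-integrable [set: T] (fun w => h (X w, Y w)) ->
  (\int[P]_w h (X w, Y w) =
   \int[distribution P X]_x \int[distribution P Y]_y h (x, y))%E.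
Proof.
move=> mh ih.
have mXY : measurable_fun [set: T] (fun w => (X w, Y w)).
  exact/measurable_fun_pair.
pose XYm := isMeasurableFun.Build _ _ _ _ _ mXY.
pose XY : {mfun T >-> (T1 * T2)%type} :=
  MeasurableFun.Pack (MeasurableFun.Class XYm).
have joint B : measurable B ->
    (distribution P X \x distribution P Y)%E B = distribution P XY B.
  by move=> mB; apply: product_measure_unique.
have prod_int : (distribution P X \x distribution P Y)%E.-integrable
    [set: T1 * T2] h.
  have /integrableP[_ hoo] : (distribution P XY).-integrable [set: T1 * T2] h.
    exact: integrable_pushforward.
  apply/integrableP; split=> //.
  rewrite (eq_measure_integral (distribution P XY)) => // B mB _.
  exact: joint.
transitivity (\int[distribution P XY]_z h z)%E.
  by rewrite integral_distribution.
rewrite -(eq_measure_integral (distribution P XY)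
  (m1 := (distribution P X \x distribution P Y)%E)) => [|B mB _]; last first.
  exact: joint.
by rewrite -integral12_prod_meas1.
Qed.

End joint_law.

(** Integrating [x * y] against the product law, the inner integral is
    [x * p], and the outer one is then [m * p]. *)
Lemma has_mean_indepM (disp : measure_display) (T : measurableType disp)
    (R : realType) (P : probability T R) (X Y : {RV P >-> R}) (m p : R) :
  (forall B C : set R, measurable B -> measurable C ->
    P (X @^-1` B `&` Y @^-1` C)%classic =
    (P (X @^-1` B)%classic * P (Y @^-1` C)%classic)%E) ->
  has_mean P X m -> has_mean P Y p ->
  P.-integrable [set: T] (EFin \o (fun w => X w * Y w)) ->
  has_mean P (fun w => X w * Y w) (m * p).
Proof.
move=> indep [iX eX] [iY eY] iXY; split=> //.
rewrite (integral_indep indep (h := fun z => (z.1 * z.2)%:E)) //=; last first.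
  by apply/measurable_EFinP; exact: measurable_funM.
transitivity (\int[distribution P X]_x (p%:E * x%:E))%E.
  apply: eq_integral => x _ /=.
  under eq_integral do rewrite EFinM.
  have iidY : (distribution P Y).-integrable [set: R] EFin.
    exact: integrable_pushforward.
  by rewrite integralZl// integral_distribution//= eY muleC.
have iidX : (distribution P X).-integrable [set: R] EFin.
  exact: integrable_pushforward.
by rewrite integralZl// integral_distribution//= eX -EFinM mulrC.
Qed.

Section noise.
Context (disp : measure_display) (T : measurableType disp) (R : realType)
  (P : probability T R) (n : nat) (sigma : R) (xi : 'I_n -> {RV P >-> R}).
Hypotheses (xi_mean : forall i, ('E_P[xi i] = 0)%E)
  (xi_var : forall i, ('V_P[xi i] = (sigma ^+ 2)%:E)%E)
  (xi_indep : mutually_independent xi).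

(** A finite variance makes the nonnegative function [xi_i^2] integrable, and
    this is what provides integrability of the noise and of its products
    below. *)
Lemma noise_sqr i : has_mean P (fun w => xi i w ^+ 2) (sigma ^+ 2).
Proof.
have e : (\int[P]_w (xi i w ^+ 2)%:E = (sigma ^+ 2)%:E)%E.
  rewrite -(xi_var i) /variance covariance.unlock xi_mean unlock.
  apply: eq_integral => w _; congr (_%:E).
  by transitivity ((xi i w - 0) * (xi i w - 0)); first by rewrite subr0.
split=> //; apply/integrableP; split.
  by apply/measurable_EFinP; exact: measurable_funX.
under eq_integral do rewrite /= ger0_norm ?sqr_ge0//.
by rewrite e ltry.
Qed.

Lemma noise_mean i : has_mean P (xi i) 0.
Proof.
split; last by have := xi_mean i; rewrite unlock.
have [i1 _] := has_meanD (has_mean_cst P 1) (noise_sqr i).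
apply: (le_integrable _ _ _ i1) => //; first exact/measurable_EFinP.
(* The dominating function is [1 + xi_i^2], as [t <= 1 + t^2]. *)
move=> w _; rewrite /= lee_fin [X in _ <= X]ger0_norm ?addr_ge0 ?sqr_ge0//.
rewrite -real_normK ?num_real//; set t := `|_|.
have := sqr_ge0 (t - 2^-1); have : 0 <= t by exact: normr_ge0.
by nra.
Qed.

Lemma noise_cross i j :
  has_mean P (fun w => xi i w * xi j w) (sigma ^+ 2 *+ (i == j)).
Proof.
have [<-|ij] := eqVneq i j.
  by under eq_fun do rewrite -expr2; exact: noise_sqr.
rewrite mulr0n -(mulr0 (0 : R)); apply: has_mean_indepM; try exact: noise_mean.
  move=> B C mB mC.
  have := xi_indep (J := [set i; j]) (B := fun l => if l == i then B else C).
  rewrite big_setU1/= ?inE// big_set1 eqxx eq_sym (negbTE ij) => <-; last first.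
    by move=> l _; case: ifP.
  congr (P _); apply/seteqP; split=> w /=.
    move=> [Bi Cj] l; rewrite !inE => /orP[]/eqP->; first by rewrite eqxx.
    by rewrite eq_sym (negbTE ij).
  move=> h; split; first by have := h i; rewrite eqxx !inE eqxx; apply.
  by have := h j; rewrite eq_sym (negbTE ij) !inE eqxx orbT; apply.
(* The dominating function is [xi_i^2 + xi_j^2]. *)
have [i2 _] := has_meanD (noise_sqr i) (noise_sqr j).
apply: (le_integrable _ _ _ i2) => //.
  by apply/measurable_EFinP; exact: measurable_funM.
move=> w _; rewrite /= lee_fin [X in _ <= X]ger0_norm ?addr_ge0 ?sqr_ge0//.
have := sqr_ge0 (xi i w + xi j w); have := sqr_ge0 (xi i w - xi j w).
have := sqr_ge0 (xi i w); have := sqr_ge0 (xi j w).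
by rewrite ler_norml => ? ? ? ?; apply/andP; split; nra.
Qed.

(** Expanding the square, the linear term averages to [0] and only the diagonal
    quadratic terms survive. *)
Lemma noise_affine_sqr (c : R) (a : 'I_n -> R) :
  has_mean P (fun w => (c + \sum_j a j * xi j w) ^+ 2)
    (c ^+ 2 + sigma ^+ 2 * \sum_j a j ^+ 2).
Proof.
have -> : (fun w => (c + \sum_j a j * xi j w) ^+ 2) =
    (fun w => (c ^+ 2 + (c *+ 2) * \sum_j a j * xi j w) +
      \sum_i \sum_j (a i * a j) * (xi i w * xi j w)).
  apply/funext => w; rewrite sqrrD mulrnAl; congr (_ + _).
  rewrite expr2 mulr_suml; apply: eq_bigr => i _; rewrite mulr_sumr.
  by apply: eq_bigr => j _; rewrite mulrACA.
have -> : c ^+ 2 + sigma ^+ 2 * \sum_j a j ^+ 2 =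
    (c ^+ 2 + (c *+ 2) * \sum_j a j * 0) +
      \sum_i \sum_j (a i * a j) * (sigma ^+ 2 *+ (i == j)).
  rewrite [\sum_j a j * 0]big1 => [|j _]; last exact: mulr0.
  rewrite mulr0 addr0; congr (_ + _); rewrite mulr_sumr.
  apply: eq_bigr => i _; rewrite (bigD1 i)//= eqxx mulr1n mulrC big1 ?addr0//.
  by move=> j ji; rewrite eq_sym (negbTE ji) mulr0.
apply: has_meanD.
  apply: has_meanD; first exact: has_mean_cst.
  apply: has_meanZ; apply: has_mean_sum => j; apply: has_meanZ.
  exact: noise_mean.
do 2!apply: has_mean_sum => ?; apply: has_meanZ; exact: noise_cross.
Qed.

End noise.

(** * Excess risk *)

Section risk.
Context (disp : measure_display) (T : measurableType disp) (R : realType)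
  (P : probability T R) (n d : nat) (sigma : R) (xi : 'I_n -> {RV P >-> R})
  (A : 'M[R]_(n, d)) (f : 'cV[R]_n).
Hypotheses (xi_mean : forall i, ('E_P[xi i] = 0)%E)
  (xi_var : forall i, ('V_P[xi i] = (sigma ^+ 2)%:E)%E)
  (xi_indep : mutually_independent xi).

Let fitted := A *m Defs.pinv A *m f.

Lemma noise_affine_l2norm (m : nat) (u : 'cV[R]_m) (M : 'M[R]_(m, n)) :
  has_mean P (fun w => l2norm (u + M *m \col_j xi j w) ^+ 2)
    (l2norm u ^+ 2 + sigma ^+ 2 * \tr (M *m M^T)).
Proof.
have -> : l2norm u ^+ 2 + sigma ^+ 2 * \tr (M *m M^T) =
    \sum_i (u i ord0 ^+ 2 + sigma ^+ 2 * \sum_j M i j ^+ 2).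
  rewrite big_split/= -l2norm_sqr_sum -mulr_sumr; congr (_ + _ * _).
  apply: eq_bigr => i _; rewrite mxE; apply: eq_bigr => j _.
  by rewrite mxE expr2.
under eq_fun do rewrite l2norm_sqr_sum.
apply: has_mean_sum => i.
have -> : (fun w => (u + M *m \col_j xi j w) i ord0 ^+ 2) =
    (fun w => (u i ord0 + \sum_j M i j * xi j w) ^+ 2).
  apply/funext => w; rewrite !mxE; congr ((_ + _) ^+ 2).
  by apply: eq_bigr => j _; rewrite mxE.
exact: noise_affine_sqr.
Qed.

(** The residual is [(A x - f) - xi], which is where the matrix [- 1%:M] comes
    from. *)
Lemma riskE (x : 'cV[R]_d) :
  (risk P A (response f xi) x =
   ((l2norm (A *m x - f) ^+ 2 + sigma ^+ 2 * n%:R) / n%:R)%:E)%E.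
Proof.
have := noise_affine_l2norm (A *m x - f) (- 1%:M).
rewrite linearN/= mulNmx mulmxN opprK trmx1 mulmx1 mxtrace1.
move=> /(has_meanZ n%:R^-1)/has_mean_expectation; rewrite mulrC => <-.
congr ('E_P[_])%E; apply/funext => w; rewrite mulrC; congr (_ * l2norm _ ^+ 2).
by rewrite mulNmx mul1mx /response opprD addrA.
Qed.

(** The residual [A x - f] splits orthogonally as [(A x - fitted)] plus
    [(fitted - f)], so comparing [xstar] with [A^+ f], whose risk involves only
    the second part, forces the first part to vanish. *)
Lemma min_norm_minimizer_fitted (xstar : 'cV[R]_d) : (0 < n)%N ->
  min_norm_minimizer (risk P A (response f xi)) xstar ->
  A *m xstar = fitted.
Proof.
move=> n0 [/(_ (Defs.pinv A *m f)) + _]; rewrite !riskE lee_fin.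
rewrite ler_pM2r ?invr_gt0 ?ltr0n// lerD2r mulmxA -/fitted => le_opt.
have [APA _ PT _] := Defs.pinvP A.
have -> : A *m xstar = fitted + (A *m xstar - fitted) by rewrite addrC subrK.
suff /l2norm_eq0 -> : l2norm (A *m xstar - fitted) = 0 by rewrite addr0.
have orth : (A *m xstar - fitted)^T *m (fitted - f) = 0.
  have -> : A *m xstar - fitted = A *m (xstar - Defs.pinv A *m f).
    by rewrite mulmxBr mulmxA.
  rewrite trmx_mul -mulmxA mulmxBr /fitted mulmxA -{1}PT -trmx_mul APA.
  by rewrite subrr mulmx0.
have split_residual :
    A *m xstar - f = (A *m xstar - fitted) + (fitted - f).
  by rewrite addrA subrK.
move: le_opt; rewrite split_residual l2norm_sqrD orth mxE.
rewrite mul0rn addr0 gerDr => le0.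
by apply/eqP; rewrite -sqrf_eq0 eq_le sqr_ge0 andbT.
Qed.

(** The factorization [Q = A *m B] says that the range of [Q] lies in that of
    [A]; then [A A^+] fixes [Q], so [Q *m fitted = Q *m f] and the bias becomes
    an expression that is linear in [Q]. *)
Lemma excess_riskE (Q : 'M[R]_n) (B : 'M[R]_(d, n))
    (theta : 'cV[R]_n -> 'cV[R]_d) (xstar : 'cV[R]_d) :
  Q = A *m B -> Q^T = Q -> Q *m Q = Q -> (forall b, A *m theta b = Q *m b) ->
  A *m xstar = fitted ->
  (excess_risk P A (response f xi) xstar theta =
   ((l2norm fitted ^+ 2 - (f^T *m Q *m f) ord0 ord0 + sigma ^+ 2 * \tr Q)
      / n%:R)%:E)%E.
Proof.
move=> QA QT QQ thetaE xstarE.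
have [APA _ PT _] := Defs.pinvP A.
have PQ : A *m Defs.pinv A *m Q = Q by rewrite {1}QA mulmxA APA -QA.
have Qfitted : Q *m fitted = Q *m f.
  by rewrite /fitted mulmxA -{1}QT -{1}PT -trmx_mul PQ QT.
have bias : l2norm (Q *m f - fitted) ^+ 2 =
    l2norm fitted ^+ 2 - (f^T *m Q *m f) ord0 ord0.
  rewrite l2norm_sqrD l2normN mulmxN l2norm_sqr trmx_mul QT.
  rewrite -!mulmxA Qfitted (mulmxA Q Q) QQ !mulmxA.
  by rewrite [X in _ + X *+ 2]mxE mulNrn mulr2n; ring.
have := noise_affine_l2norm (Q *m f - fitted) Q.
rewrite bias QT QQ => /(has_meanZ n%:R^-1)/has_mean_expectation.
rewrite mulrC => <-.
congr ('E_P[_])%E; apply/funext => w; rewrite mulrC; congr (_ * l2norm _ ^+ 2).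
by rewrite thetaE xstarE /response mulmxDr addrAC.
Qed.

End risk.

Theorem theorem12 (R : realType) (n d s k : nat)
    (A : 'M[R]_(n, d)) (DA : thin_svd A)
    (S : 'M[R]_(d, s)) (DAS : thin_svd (A *m S))
    (disp : measure_display) (T : measurableType disp) (P : probability T R)
    (f : 'cV[R]_n) (sigma : R) (xi : 'I_n -> {RV P >-> R})
    (xstar : 'cV[R]_d) (nu : R) :
  (1 <= k)%N ->
  (k <= \rank A)%N ->
  singular_value DA k.+1 < singular_value DA k ->
  (forall i, 'E_P[xi i] = 0)%E ->
  (forall i, 'V_P[xi i] = (sigma ^+ 2)%:E)%E ->
  mutually_independent xi ->
  min_norm_minimizer (risk P A (response f xi)) xstar ->
  (k <= s)%N ->
  (k <= \rank (A *m S))%N ->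
  d2 (firstcols k (svdU DAS)) (firstcols k (svdU DA)) <= nu ->
  nu < 1 ->
  (excess_risk P A (response f xi) xstar (sketched_pcr k DAS) <=
   excess_risk P A (response f xi) xstar (pcr k DA) +
     ((2 * nu + nu ^+ 2) * l2norm f ^+ 2 / n%:R)%:E)%E.
Proof.
move=> k_gt0 rank_A _ xi_mean xi_var xi_indep xstar_min _ rank_AS d2_nu _.
have n_gt0 : (0 < n)%N.
  exact: leq_trans k_gt0 (leq_trans rank_A (rank_leq_row A)).
have xstarE :=
  min_norm_minimizer_fitted xi_mean xi_var xi_indep n_gt0 xstar_min.
set U1 := firstcols k (svdU DAS) in d2_nu.
set U0 := firstcols k (svdU DA) in d2_nu.
have UU1 : U1^T *m U1 = 1%:M := firstcols_svdU_orthonormal DAS rank_AS.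
have UU0 : U0^T *m U0 = 1%:M := firstcols_svdU_orthonormal DA rank_A.
have idem (U : 'M[R]_(n, k)) : U^T *m U = 1%:M ->
    (U *m U^T) *m (U *m U^T) = U *m U^T.
  by move=> UU; rewrite mulmxA -(mulmxA U) UU mulmx1.
have trace (U : 'M[R]_(n, k)) : U^T *m U = 1%:M -> \tr (U *m U^T) = k%:R.
  by move=> UU; rewrite mxtrace_mulC UU mxtrace1.
have sym (U : 'M[R]_(n, k)) : (U *m U^T)^T = U *m U^T.
  by rewrite trmx_mul trmxK.
have fit1 := fitted_firstcols DAS rank_AS.
have fit0 := fitted_firstcols DA rank_A.
rewrite (@excess_riskE _ _ _ _ _ _ sigma _ _ _ _ _ _ (U1 *m U1^T)
  (S *m firstcols k (svdV DAS) *m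
     Defs.pinv (A *m S *m firstcols k (svdV DAS))))//; last first.
- by move=> b; rewrite /sketched_pcr !mulmxA -fit1 !mulmxA.
- exact: idem.
- by rewrite -fit1 !mulmxA.
rewrite (@excess_riskE _ _ _ _ _ _ sigma _ _ _ _ _ _ (U0 *m U0^T)
  (firstcols k (svdV DA) *m
     Defs.pinv (A *m firstcols k (svdV DA))))//; last first.
- by move=> b; rewrite /pcr !mulmxA -fit0 !mulmxA.
- exact: idem.
- by rewrite -fit0 !mulmxA.
rewrite -EFinD lee_fin !trace// -mulrDl ler_pM2r ?invr_gt0 ?ltr0n//.
have nu_ge0 : 0 <= nu by apply: le_trans d2_nu; exact: spectral_norm_ge0.
(* The vectors [f] and [- f] put [U1 U1^T - U0 U0^T], the matrix in [d2], in
   place of its opposite. *)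
have gap : (f^T *m (U0 *m U0^T) *m f) ord0 ord0 -
    (f^T *m (U1 *m U1^T) *m f) ord0 ord0 <= nu * l2norm f ^+ 2.
  apply: le_trans (ler_wpM2r (sqr_ge0 _) d2_nu).
  rewrite /d2 !orthproj_isometry// expr2 mulrA.
  have := mulmx_spectral_le (U1 *m U1^T - U0 *m U0^T) f (- f).
  rewrite l2normN; apply: le_trans.
  by rewrite linearN/= mulNmx -mulmxN opprB mulmxBr mulmxBl 
    [X in _ <= X]mxE lerD2l [X in _ <= X]mxE.
have : 0 <= (nu + nu ^+ 2) * l2norm f ^+ 2.
  by rewrite mulr_ge0 ?addr_ge0 ?sqr_ge0.
by lra.
Qed.
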